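(* For a greedy reading policy, with $R_{\mathbf G}(n)$ the number of records read from $\mathbf R$ among the first $n$, $$\frac{R_{\mathbf G}(n)-n/2}{\sqrt n}\xrightarrow{d}\mathrm N(0,\sigma_{R_{\mathbf G}}^2)\quad(n\to\infty),\qquad \sigma_{R_{\mathbf G}}^2:=\frac{\sigma_{\mathbf R}^2+\sigma_{\mathbf S}^2}{8\mu^2}.$$
   Context: Let $(r_i)_{i\ge1}$, $(s_i)_{i\ge1}$ be probability vectors on the positive integers with $\mu:=\sum_i r_is_i>0$. Let $\{L_{\mathbf R}(n)\}_{n\ge1}$, $\{L_{\mathbf S}(n)\}_{n\ge1}$ be independent i.i.d. sequences with $\Pr(L_{\mathbf R}(1)=i)=r_i$, $\Pr(L_{\mathbf S}(1)=i)=s_i$. Put $X_{\mathbf R}(n)=s_{L_{\mathbf R}(n)}$, $X_{\mathbf S}(n)=r_{L_{\mathbf S}(n)}$ (common mean $\mu$, variances $\sigma_{\mathbf R}^2,\sigma_{\mathbf S}^2$; standing assumption $\sigma_{\mathbf R}+\sigma_{\mathbf S}>0$), and $\Gamma_{\mathbf R}[m]=\sum_{j=1}^mX_{\mathbf R}(j)$, $\Gamma_{\mathbf S}[m]=\sum_{j=1}^mX_{\mathbf S}(j)$. A reading policy is a $\{0,1\}$-valued process $C(n)$ ($C(n)=1$ iff the $n$-th record is read from $\mathbf R$), $R(n)=\sum_{j\le n}C(j)$, $S(n)=n-R(n)$, with $C(n)$ being $\mathcal F_{n-1}$-measurable where $\mathcal F_n=\mathcal F_0\vee\sigma(L_{\mathbf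 R}(1),\dots,L_{\mathbf R}(R(n));L_{\mathbf S}(1),\dots,L_{\mathbf S}(S(n)))$ and $\mathcal F_0$ (randomization) is independent of the labels. A greedy policy satisfies, for $n\ge1$, $C(n+1)=1$ if $\Gamma_{\mathbf S}[S(n)]>\Gamma_{\mathbf R}[R(n)]$ and $C(n+1)=0$ if $\Gamma_{\mathbf S}[S(n)]<\Gamma_{\mathbf R}[R(n)]$ (ties arbitrary); the subscript $\mathbf G$ refers to it. *)

(* Defs.v *)
From HB Require Import structures.
From mathcomp Require Import all_boot all_order all_algebra.
From mathcomp Require Import all_classical all_reals all_analysis.
Set Implicit Arguments. Unset Strict Implicit. Unset Printing Implicit Defensive.
Import Order.TTheory GRing.Theory Num.Theory.
Import numFieldNormedType.Exports.
Local Open Scope classical_set_scope.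
Local Open Scope ring_scope.

Section GreedyDefs.
Variables (R : realType) (d : measure_display) (Omega : measurableType d).

(* r, s : probability vectors on the labels; labels are nat, label 0 is given
   probability 0 by hypothesis in the theorem (labels are positive integers). *)

Definition mu_rs (r s : nat -> R) : R := limn (fun n => \sum_(0 <= i < n) (r i * s i)).

(* Var(X_R(1)) where X_R(1) = s_{L_R(1)}, L_R(1) ~ r *)
Definition sigmaR2 (r s : nat -> R) : R :=
  limn (fun n => \sum_(0 <= i < n) (r i * (s i) ^+ 2)) - (mu_rs r s) ^+ 2.
(* Var(X_S(1)) where X_S(1) = r_{L_S(1)}, L_S(1) ~ s *)
Definition sigmaS2 (r s : nat -> R) : R :=
  limn (fun n => \sum_(0 <= i < n) (s i * (r i) ^+ 2)) - (mu_rs r s) ^+ 2.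

Definition GammaR (s : nat -> R) (LR : nat -> Omega -> nat) (m : nat)
  (w : Omega) : R := \sum_(1 <= j < m.+1) s (LR j w).
Definition GammaS (r : nat -> R) (LS : nat -> Omega -> nat) (m : nat)
  (w : Omega) : R := \sum_(1 <= j < m.+1) r (LS j w).

Definition Rcount (C : nat -> Omega -> bool) (n : nat) (w : Omega) : nat :=
  (\sum_(1 <= j < n.+1) C j w)%N.
Definition Scount (C : nat -> Omega -> bool) (n : nat) (w : Omega) : nat :=
  (n - Rcount C n w)%N.

Definition history (LR LS : nat -> Omega -> nat) (C : nat -> Omega -> bool)
  (n : nat) (w : Omega) : seq nat * seq nat :=
  ([seq LR j w | j <- iota 1 (Rcount C n w)],
   [seq LS j w | j <- iota 1 (Scount C n w)]).

Definition filtr (F0 : set (set Omega)) (LR LS : nat -> Omega -> nat)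
  (C : nat -> Omega -> bool) (n : nat) : set (set Omega) :=
  <<s F0 `|` [set history LR LS C n @^-1` A | A in [set: set (seq nat * seq nat)]] >>.

Definition reading_policy (F0 : set (set Omega)) (LR LS : nat -> Omega -> nat)
  (C : nat -> Omega -> bool) : Prop :=
  forall n, (1 <= n)%N -> filtr F0 LR LS C n.-1 [set w | C n w].

Definition greedy (r s : nat -> R) (LR LS : nat -> Omega -> nat)
  (C : nat -> Omega -> bool) : Prop :=
  forall n w, (1 <= n)%N ->
    (GammaS r LS (Scount C n w) w > GammaR s LR (Rcount C n w) w -> C n.+1 w = true) /\
    (GammaS r LS (Scount C n w) w < GammaR s LR (Rcount C n w) w -> C n.+1 w = false).

(* Probabilistic model: the labels are measurable; (L_R(n))_{n>=1} i.i.d. with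
   law r, (L_S(n))_{n>=1} i.i.d. with law s, the two sequences independent, and
   all labels jointly independent of the sigma-algebra F_0 (randomization).
   Since labels are discrete, this is expressed by the product rule on
   cylinder events: for A in F_0 (A = setT allowed),
   P(A /\ L_R(j)=a_j, L_S(j)=b_j for 1<=j<=N) = P(A) * prod_j r_{a_j} s_{b_j}. *)
Definition label_model (P : probability Omega R) (r s : nat -> R)
  (LR LS : nat -> Omega -> nat) (F0 : set (set Omega)) : Prop :=
  [/\ (forall n i, measurable (LR n @^-1` [set i])),
      (forall n i, measurable (LS n @^-1` [set i])),
      sigma_algebra setT F0,
      F0 `<=` measurable &
      (forall A, F0 A -> forall (N : nat) (a b : nat -> nat),
        P (A `&` [set w | forall j, (1 <= j <= N)%N -> LR j w = a j /\ LS j w = b j])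
        = (P A * (\prod_(1 <= j < N.+1) (r (a j) * s (b j)))%:E)%E)].

End GreedyDefs.

(* Main.v *)
(** Since labels contribute at most 1, greediness keeps [GammaS] and [GammaR]
    within distance 1 of each other along the reading.  As both are
    nondecreasing in the number of records read, [R_G(n) <= k] forces
    [GammaS(n-k) - GammaR(k) <= 1] and [R_G(n) > k] forces
    [GammaR(k) - GammaS(n-k) <= 1].  With [k ~ n/2 + x sqrt n] both events
    concern sums of independent bounded variables, and upper bounds for the two
    probabilities suffice because the two events on [R_G(n)] are complementary.

    The normal upper bound is a Lindeberg argument driven by the heat equation:
    [(t, x) |-> Phi (x / sqrt t)] solves [F_t = F_xx / 2], so averaging it over
    one centred bounded label of variance [v] moves [t] to [t + v] up to
    [O(t^(-3/2))]. *)
Require Import Defs.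
From HB Require Import structures.
From mathcomp Require Import all_boot all_order all_algebra.
From mathcomp Require Import all_classical all_reals all_analysis.
From mathcomp Require Import ring lra zify.
Import Order.TTheory GRing.Theory Num.Theory.
Import numFieldNormedType.Exports.
Local Open Scope classical_set_scope.
Local Open Scope ring_scope.
Set Implicit Arguments. Unset Strict Implicit. Unset Printing Implicit Defensive.

(** * Taylor expansions on the line with Lagrange remainder *)

Section taylor.
Context {R : realType}.

(** Rolle's theorem for [h], where [k] is chosen so that [h a = h b]. The derivative of [h] has the
    factor [b - x], nonzero in the interior, so the other factor [f2 x - 2 * k] must vanish at the
    Rolle point. *)
Lemma taylor2_lagrange_lt (f f1 f2 : R -> R) (a b : R) : a < b ->
  (forall x : R, is_derive x (1 : R) f (f1 x)) -> (forall x : R, is_derive x (1 : R) f1 (f2 x)) ->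
  exists2 c, a <= c <= b & f b = f a + (b - a) * f1 a + (b - a) ^+ 2 / 2 * f2 c.
Proof.
move=> ab df df1.
pose k := (f b - f a - (b - a) * f1 a) / (b - a) ^+ 2.
pose h x := f x + (b - x) * f1 x + k * (b - x) ^+ 2.
have dh x : is_derive x (1 : R) h ((b - x) * (f2 x - 2 * k)).
  have := df x; have := df1 x => dfx1 dfx.
  rewrite /h; apply: is_derive_eq.
  by rewrite /GRing.scale /=; ring.
have ba0 : (b - a) ^+ 2 != 0 by rewrite expf_neq0// subr_eq0 gt_eqF.
have hab : h a = h b.
  rewrite /h /k divfK//; ring.
have hc : {within `[a, b], continuous h}.
  apply: continuous_subspaceT => x.
  by apply: differentiable_continuous; apply/derivable1_diffP; have [] := dh x.
have [c cab hc0] := Rolle ab (fun x _ => @ex_derive _ _ _ _ _ _ _ (dh x)) hc hab.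
have /andP[ac cb] : a < c < b by move: cab; rewrite in_itv.
exists c; first by rewrite !ltW.
have : (b - c) * (f2 c - 2 * k) = 0.
  by have [_ <-] := dh c; have [_ <-] := hc0.
move/eqP; rewrite mulf_eq0 subr_eq0 (gt_eqF cb)/= subr_eq0 => /eqP ->.
by rewrite /k; field; rewrite subr_eq0 gt_eqF.
Qed.

Lemma taylor2_lagrange (f f1 f2 : R -> R) (a b : R) :
  (forall x : R, is_derive x (1 : R) f (f1 x)) -> (forall x : R, is_derive x (1 : R) f1 (f2 x)) ->
  exists2 c, (a <= c <= b) || (b <= c <= a) &
    f b = f a + (b - a) * f1 a + (b - a) ^+ 2 / 2 * f2 c.
Proof.
move=> df df1; have [ab|ba|<-] := ltgtP a b.
- by have [c cab fb] := taylor2_lagrange_lt ab df df1; exists c; rewrite ?cab.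
(* For [b < a] the ordered case is applied to the reflected function [y |-> f (- y)]. *)
- have dN (g g' : R -> R) : (forall x : R, is_derive x (1 : R) g (g' x)) ->
      forall x : R, is_derive x (1 : R) (fun y => g (- y)) (- g' (- x)).
    move=> dg x; have dgx := dg (- x).
    have := @is_derive1_comp _ g (-%R) x _ _ dgx (is_deriveNid x 1).
    by rewrite mulrN1.
  have dN1 : forall x : R, is_derive x (1 : R) (fun y => - f1 (- y)) (f2 (- x)).
    by move=> x; have := dN _ _ df1 x => d; apply: is_derive_eq; rewrite opprK.
  have ab : - a < - b by rewrite ltrN2.
  have [c /andP[ac cb]] := taylor2_lagrange_lt ab (dN _ _ df) dN1.
  rewrite !opprK => fb; exists (- c); first by apply/orP; right; apply/andP; split; lra.
  by rewrite fb; field.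
- by exists a; rewrite ?lexx//; ring.
Qed.

(** The Lagrange point lies between [a] and [b], so by the mean value theorem [f2] changes by at
    most [K * |b - a|] from [a] to that point. This yields the constant [K / 2], relaxed to [K]. *)
Lemma taylor3_ub (f f1 f2 f3 : R -> R) (K a b : R) :
  (forall x : R, is_derive x (1 : R) f (f1 x)) -> (forall x : R, is_derive x (1 : R) f1 (f2 x)) ->
  (forall x : R, is_derive x (1 : R) f2 (f3 x)) -> (forall x, `|f3 x| <= K) ->
  f b <= f a + (b - a) * f1 a + (b - a) ^+ 2 / 2 * f2 a + K * `|b - a| ^+ 3.
Proof.
move=> df df1 df2 f3K; have [c cab ->] := taylor2_lagrange a b df df1.
have K0 : 0 <= K by exact: le_trans (f3K 0).
have ca : `|c - a| <= `|b - a|.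
  case/orP: cab => /andP[? ?].
    by rewrite !ger0_norm ?subr_ge0//; lra.
  by rewrite !ler0_norm ?subr_le0//; lra.
have f2c : f2 c - f2 a <= K * `|b - a|.
  have : `|f2 c - f2 a| <= K * `|c - a|.
    wlog ac : a c {cab ca} / a <= c => [H|].
      by have [/H//|/ltW/H] := leP a c; rewrite distrC (distrC a).
    have [z _ ->] := @MVT_segment _ f2 f3 a c ac (fun x _ => df2 x)
      (derivable_within_continuous (fun x _ => @ex_derive _ _ _ _ _ _ _ (df2 x))).
    by rewrite normrM ler_wpM2r.
  by move/(le_trans (ler_norm _))/le_trans; apply; rewrite ler_wpM2l.
rewrite -(addrA _ _ (K * _)) lerD2l.
have D2 : (b - a) ^+ 2 = `|b - a| ^+ 2 by rewrite -normrX ger0_norm ?sqr_ge0.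
have D0 : 0 <= `|b - a| by [].
move: f2c D0; rewrite D2; set D := `|b - a| => f2c D0.
have H1 : 0 <= D ^+ 2 * (K * D - (f2 c - f2 a)).
  by rewrite mulr_ge0 ?sqr_ge0// subr_ge0.
have H2 : 0 <= K * D ^+ 3 by rewrite mulr_ge0// exprn_ge0.
have E : K * D ^+ 3 = D ^+ 2 * (K * D - (f2 c - f2 a)) + D ^+ 2 * (f2 c - f2 a).
  by ring.
lra.
Qed.

End taylor.

(** * The centred Gaussian distribution function: derivative, limits, scaling, reflection *)

Section gaussian_cdf.
Context {R : realType}.
Implicit Types (u x sigma w : R).

Definition gcdf sigma x : R := fine (normal_prob 0 sigma `]-oo, x]).

Lemma gcdf_fin sigma x : normal_prob 0 sigma `]-oo, x] \is a fin_num.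
Proof. by apply: fin_num_measure. Qed.

Lemma is_derive_gcdf sigma x : sigma != 0 ->
  is_derive x (1 : R) (gcdf sigma) (normal_pdf 0 sigma x).
Proof.
move=> s0.
(* The end point [x + 1] is arbitrary: [x] only has to be interior to the interval of
   integration. *)
have := @continuous_FTC1 R (normal_pdf 0 sigma) (BInfty _ true) x (x + 1).
rewrite ltrDl ltr01 => /(_ isT); case.
- by apply: integrableS (integrable_normal_pdf _ _).
- by rewrite ltNyr.
- exact: continuous_normal_pdf.
- by move=> dF; rewrite derive1E => F'; apply: DeriveDef.
Qed.

(** The identity, seen as a random variable under [normal_prob], makes the general facts on [cdf]
    available for [gcdf]. *)
Lemma gcdf_cdf sigma : exists X : {RV (@normal_prob R 0 sigma) >-> R},
  forall x, (gcdf sigma x)%:E = cdf X x.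
Proof.
pose X : {RV (@normal_prob R 0 sigma) >-> R} :=
  HB.pack (idfun : measurableTypeR R -> R)
  (@isMeasurableFun.Build _ _ _ _ (idfun : measurableTypeR R -> R) (@measurable_id _ _ setT)).
by exists X => x; rewrite /gcdf fineK ?gcdf_fin.
Qed.

Lemma cvg_gcdfy sigma : gcdf sigma @ +oo --> (1 : R).
Proof.
have [X XE] := gcdf_cdf sigma.
have := cvg_cdfy1 X; rewrite -(_ : EFin \o gcdf sigma = cdf X).
  by move/fine_cvg.
by apply/funext => x /=; rewrite XE.
Qed.

Lemma cvg_gcdfNy sigma : gcdf sigma @ -oo --> (0 : R).
Proof.
have [X XE] := gcdf_cdf sigma.
have := cvg_cdfNy0 X; rewrite -(_ : EFin \o gcdf sigma = cdf X).
  by move/fine_cvg.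
by apply/funext => x /=; rewrite XE.
Qed.

Lemma gcdf_le sigma x y : x <= y -> gcdf sigma x <= gcdf sigma y.
Proof.
have [X XE] := gcdf_cdf sigma.
by move=> xy; rewrite -lee_fin !XE; exact: cdf_nondecreasing.
Qed.

Lemma gcdf_ge0 sigma x : 0 <= gcdf sigma x.
Proof. by rewrite fine_ge0. Qed.

Lemma gcdf_le1 sigma x : gcdf sigma x <= 1.
Proof.
by have [X XE] := gcdf_cdf sigma; rewrite -lee_fin XE; exact: cdf_le1.
Qed.

(** Both sides have the same derivative in [x], so they differ by a constant, which the common limit
    at minus infinity shows to be zero. *)
Lemma gcdf_scale sigma x : 0 < sigma -> gcdf sigma x = gcdf 1 (x / sigma).
Proof.
move=> s0; pose D x := gcdf sigma x - gcdf 1 (x / sigma).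
have dD y : is_derive y (1 : R) D 0.
  have d1 : is_derive y (1 : R) (gcdf sigma) (normal_pdf 0 sigma y).
    by apply: is_derive_gcdf; rewrite gt_eqF.
  have d2 : is_derive (y / sigma) (1 : R) (gcdf 1) (normal_pdf 0 1 (y / sigma)).
    by apply: is_derive_gcdf; rewrite oner_eq0.
  have d3 : is_derive y (1 : R) (fun z => z / sigma) (sigma^-1).
    by apply: is_derive_eq; rewrite /GRing.scale /=; ring.
  have d4 := @is_derive1_comp _ (gcdf 1) (fun z => z / sigma) _ _ _ d2 d3.
  apply: (@is_derive_eq _ _ _ _ _ _ _ _ (is_deriveB _ _)).
  rewrite !normal_pdfE ?gt_eqF// /normal_peak /normal_fun !subr0.
  rewrite !expr1n mul1r.
  have -> : - (y / sigma) ^+ 2 / 2%:R = - y ^+ 2 / (sigma ^+ 2 *+ 2).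
    by field; rewrite gt_eqF.
  rewrite -mulrnAr sqrtrM ?sqr_ge0// sqrtr_sqr gtr0_norm//.
  by field; rewrite !gt_eqF// sqrtr_gt0 pmulrn_lgt0// pi_gt0.
have cD : D z @[z --> -oo] --> (0 : R).
  rewrite -(subrr 0); apply: cvgB; first exact: cvg_gcdfNy.
  apply: (@cvg_comp _ _ _ (fun z => z / sigma) (gcdf 1)); last exact: cvg_gcdfNy.
  by apply/gt0_cvgMlNy; rewrite ?invr_gt0.
have : D z @[z --> -oo] --> D x.
  by rewrite (_ : D = cst (D x)); [exact: cvg_cst|apply/funext => z; exact: is_derive_0_is_cst].
move/(cvg_unique _ cD) => /(_ (@Rhausdorff R))/esym/eqP.
by rewrite subr_eq0 => /eqP.
Qed.

(** The density is even, so [gcdf 1 x + gcdf 1 (- x)] has zero derivative; its limit at plus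
    infinity is 1. *)
Lemma gcdfN x : gcdf 1 (- x) = 1 - gcdf 1 x.
Proof.
pose D x := gcdf 1 x + gcdf 1 (- x).
have dD y : is_derive y (1 : R) D 0.
  have d1 z : is_derive z (1 : R) (gcdf 1) (normal_pdf 0 1 z).
    by apply: is_derive_gcdf; rewrite oner_eq0.
  have d4 := @is_derive1_comp _ (gcdf 1) -%R _ _ _ (d1 (- y)) (is_deriveNid y 1).
  apply: (@is_derive_eq _ _ _ _ _ _ _ _ (is_deriveD _ _)).
  rewrite !normal_pdfE ?oner_eq0// /normal_fun !subr0 sqrrN; ring.
have cD : D z @[z --> +oo] --> (1 : R).
  rewrite -[1]addr0; apply: cvgD; first exact: cvg_gcdfy.
  apply: (@cvg_comp _ _ _ -%R (gcdf 1)); last exact: cvg_gcdfNy.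
  exact/cvgNrNy/cvg_id.
have : D z @[z --> +oo] --> D x.
  by rewrite (_ : D = cst (D x)); [exact: cvg_cst|apply/funext => z; exact: is_derive_0_is_cst].
move/(cvg_unique _ cD) => /(_ (@Rhausdorff R)) D1.
by apply/eqP; rewrite eq_sym subr_eq addrC -/(D x) -D1.
Qed.

Lemma gcdf_continuous : continuous (gcdf 1).
Proof.
move=> x; apply: differentiable_continuous; apply/derivable1_diffP.
by have [] := @is_derive_gcdf 1 x (oner_neq0 _).
Qed.

End gaussian_cdf.

(** * Uniform bounds on Gaussian derivatives and the effect of widening the Gaussian *)

Section gaussian_taylor.
Context {R : realType}.
Implicit Types (u x w : R).

Definition gpdf x : R := normal_pdf 0 1 x.

Lemma gpdfE x : gpdf x = normal_peak 1 * expR (- x ^+ 2 / 2).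
Proof. by rewrite /gpdf normal_pdfE ?oner_eq0// /normal_fun subr0 expr1n. Qed.

Lemma gpdf_ge0 x : 0 <= gpdf x.
Proof. exact: normal_pdf_ge0. Qed.

Lemma is_derive_gpdf x : is_derive x (1 : R) gpdf (- x * gpdf x).
Proof.
have -> : gpdf = fun y => normal_peak 1 * expR (- y ^+ 2 / 2).
  by apply/funext => y; rewrite gpdfE.
have d1 : is_derive x (1 : R) (fun y => - y ^+ 2 / 2) (- x).
  by apply: is_derive_eq; rewrite /GRing.scale /=; field.
have d2 := @is_derive1_comp _ expR (fun y => - y ^+ 2 / 2) x _ _ (is_derive_expR _) d1.
apply: (@is_derive_eq _ _ _ _ _ _ _ _ (is_deriveZ _ _)).
by rewrite /GRing.scale /=; ring.
Qed.

(** The peak is at most 1, and [expR (x ^+ 2 / 2)] is the square of [expR (x ^+ 2 / 4)], which is at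
    least [1 + x ^+ 2 / 4]. This quartic decay absorbs the polynomial factors of degree at most
    three met below. *)
Lemma gpdf_le x : gpdf x * (1 + x ^+ 2 / 4) ^+ 2 <= 1.
Proof.
have peak1 : normal_peak (1 : R) <= 1.
  have p0 : 0 < pi *+ 2 :> R by rewrite pmulrn_lgt0// pi_gt0.
  rewrite /normal_peak expr1n mul1r invf_le1 ?sqrtr_gt0//.
  rewrite -sqrtr1 ler_wsqrtr//; have := @pi_ge2 R; lra.
have e2 : expR (x ^+ 2 / 2) = expR (x ^+ 2 / 4) ^+ 2.
  by rewrite -expRM_natl; congr expR; field.
have le_e : (1 + x ^+ 2 / 4) ^+ 2 <= expR (x ^+ 2 / 2).
  rewrite e2 lerXn2r ?nnegrE ?expR_ge0 ?expR_ge1Dx//.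
  by rewrite addr_ge0// mulr_ge0// sqr_ge0.
rewrite gpdfE mulNr expRN.
apply: le_trans (_ : normal_peak 1 * (expR (x ^+ 2 / 2))^-1 * expR (x ^+ 2 / 2) <= _).
  by rewrite ler_wpM2l// mulr_ge0 ?normal_peak_ge0// invr_ge0 expR_ge0.
by rewrite mulfVK// gt_eqF// expR_gt0.
Qed.

(** The factor 16 turns the quartic into [x^4 + 8 x^2 + 16], which dominates [x], [x^2 - 1] and
    [x^3] in absolute value; one constant thus serves for all three. *)
Lemma gpdf_mul_le (c x : R) : `|c| <= 16 * (1 + x ^+ 2 / 4) ^+ 2 -> `|c * gpdf x| <= 16.
Proof.
move=> cle; rewrite normrM (ger0_norm (gpdf_ge0 x)).
apply: le_trans (_ : 16 * (1 + x ^+ 2 / 4) ^+ 2 * gpdf x <= _).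
  by rewrite ler_wpM2r ?gpdf_ge0.
have := gpdf_le x; rewrite mulrC -(mulrA 16); set y := _ * gpdf x.
by rewrite mulrC -/y; lra.
Qed.

(** With [gcdf3], the second and third derivatives of [gcdf 1]. *)
Definition gcdf2 x : R := - x * gpdf x.
Definition gcdf3 x : R := (x ^+ 2 - 1) * gpdf x.

Lemma is_derive_gcdf1 x : is_derive x (1 : R) (gcdf 1) (gpdf x).
Proof. by apply: is_derive_gcdf; rewrite oner_eq0. Qed.

Lemma is_derive_gcdf2 x : is_derive x (1 : R) gcdf2 (gcdf3 x).
Proof.
have d := is_derive_gpdf x.
apply: (@is_derive_eq _ _ _ _ _ _ _ _ (is_deriveM _ _)).
by rewrite /GRing.scale /gcdf3 /=; ring.
Qed.

Lemma gcdf3_le x : `|gcdf3 x| <= 16.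
Proof.
apply: gpdf_mul_le; rewrite ler_norml; have := sqr_ge0 x; move: (x ^+ 2) => y y0.
by apply/andP; split; nra.
Qed.

Lemma gcdf2_le x : `|gcdf2 x| <= 16.
Proof.
apply: gpdf_mul_le; rewrite normrN.
have := normr_ge0 x; rewrite -[x ^+ 2]real_normK ?num_real//.
move: (`|x|) => y y0; nra.
Qed.

Lemma cube_gpdf_le x : `|x ^+ 3 * gpdf x| <= 16.
Proof.
apply: gpdf_mul_le; rewrite normrX.
have := normr_ge0 x; rewrite -[x ^+ 2]real_normK ?num_real//.
move: (`|x|) => y y0.
(* This square gives [2 y^3 <= y^4 + y^2]. *)
have : 0 <= y ^+ 2 * (y - 1) ^+ 2 by rewrite mulr_ge0 ?sqr_ge0.
have : 0 <= y ^+ 2 by exact: sqr_ge0.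
have -> : (1 + y ^+ 2 / 4) ^+ 2 = 1 + y ^+ 2 / 2 + y ^+ 4 / 16 by field.
have -> : y ^+ 2 * (y - 1) ^+ 2 = y ^+ 4 - 2 * y ^+ 3 + y ^+ 2 by ring.
have : 0 <= y ^+ 4 by rewrite exprn_ge0.
lra.
Qed.

(** A discrete form of the heat equation: raising the variance from 1 to [1 + w] adds [w / 2] times
    the second derivative, up to [O(w^2)]. In a Taylor expansion from [u] to [u / Num.sqrt (1 + w)]
    the first order term is close to [w / 2 * gcdf2 u], and the errors are uniform in [u] by
    Gaussian decay. *)
Lemma gcdf_shrink u w : 0 <= w ->
  gcdf 1 u + w / 2 * gcdf2 u <= gcdf 1 (u / Num.sqrt (1 + w)) + 16 * w ^+ 2.
Proof.
move=> w0; set rt := Num.sqrt (1 + w).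
have rt2 : rt ^+ 2 = 1 + w by rewrite sqr_sqrtr// addr_ge0.
have rt1 : 1 <= rt by rewrite -sqrtr1 ler_wsqrtr// lerDl.
have rt0 : 0 < rt by exact: lt_le_trans rt1.
have rtw : rt - 1 <= w / 2 by have := sqr_ge0 (rt - 1); nra.
have wE : w = rt ^+ 2 - 1 by rewrite rt2; ring.
have [c + ->] := taylor2_lagrange u (u / rt) is_derive_gcdf1 is_derive_gpdf.
set v := u / rt => cub.
have uv : u = v * rt by rewrite /v divfK// gt_eqF.
(* [v] and [u] have the same sign and [v] is the closer to zero, so every point [c] between them
   satisfies this. It moves the powers of [v] to [c], where [cube_gpdf_le] applies. *)
have vc : v ^+ 2 <= c ^+ 2.
  by case/orP: cub => /andP[]; have [v0|v0] := leP 0 v; nra.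
have vu2 : (v - u) ^+ 2 <= c ^+ 2 * (w ^+ 2 / 4).
  have -> : (v - u) ^+ 2 = v ^+ 2 * (rt - 1) ^+ 2 by rewrite uv; ring.
  apply: ler_pM; rewrite ?sqr_ge0//.
  have -> : w ^+ 2 / 4 = (w / 2) ^+ 2 by field.
  by rewrite lerXn2r ?nnegrE ?subr_ge0// divr_ge0.
have rem2 : - (2 * w ^+ 2) <= (v - u) ^+ 2 / 2 * - c * gpdf c.
  have -> : (v - u) ^+ 2 / 2 * - c * gpdf c = - ((v - u) ^+ 2 / 2 * (c * gpdf c)) by ring.
  rewrite lerN2; apply: le_trans (ler_norm _) _.
  rewrite normrM (ger0_norm (divr_ge0 (sqr_ge0 _) _))//.
  apply: le_trans (_ : c ^+ 2 * (w ^+ 2 / 4) / 2 * `|c * gpdf c| <= _).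
    by rewrite ler_wpM2r// ler_pM2r.
  have := cube_gpdf_le c; rewrite exprSr -mulrA normrM (ger0_norm (sqr_ge0 c)) => c3.
  have := ler_wpM2l (sqr_ge0 w) c3; move: (`|_|) => n.
  lra.
have rem1 : - (6 * w ^+ 2) <= (v - u + w / 2 * u) * gpdf u.
  (* The gap between the exact shrinking factor [rt^-1 - 1] and its first order value [- w / 2]. It
     is nonnegative and quadratic in [w]. *)
  pose e := rt^-1 - 1 + w / 2.
  have eE : e = (rt - 1) ^+ 2 / rt + (rt - 1) ^+ 2 / 2.
    by rewrite /e wE; field; rewrite gt_eqF.
  have e0 : 0 <= e by rewrite eE addr_ge0 // divr_ge0 ?sqr_ge0// ltW.
  have ew : e <= 3 / 8 * w ^+ 2.
    have d2 : (rt - 1) ^+ 2 <= (w / 2) ^+ 2.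
      by rewrite lerXn2r ?nnegrE ?subr_ge0// divr_ge0.
    have : (rt - 1) ^+ 2 / rt <= (rt - 1) ^+ 2.
      by rewrite ler_pdivrMr// ler_peMr ?sqr_ge0.
    move: d2; rewrite eE (_ : (w / 2) ^+ 2 = w ^+ 2 / 4); last by field.
    lra.
  have -> : (v - u + w / 2 * u) * gpdf u = - (e * gcdf2 u).
    by rewrite /e /gcdf2 /v; ring.
  rewrite lerN2; apply: le_trans (ler_norm _) _; rewrite normrM (ger0_norm e0).
  have := ler_pM e0 (normr_ge0 _) ew (gcdf2_le u); lra.
have w2 : 0 <= w ^+ 2 by exact: sqr_ge0.
have -> : w / 2 * gcdf2 u = (v - u) * gpdf u - (v - u + w / 2 * u) * gpdf u.
  by rewrite /gcdf2; ring.
move: rem2; rewrite -mulrA; lra.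
Qed.

End gaussian_taylor.

(** * Averaging the Gaussian distribution function over one label *)

Section smoothing_step.
Context {R : realType}.

(** Partial sums of nonnegative terms increase, so each is below all later bounds [B N], hence below
    their limit; convergence of the series of [u] need not be established first. *)
Lemma le_limit_partial_sums (u B : nat -> R) (l : R) (n : nat) :
  (forall i, 0 <= u i) -> (forall N, \sum_(0 <= i < N) u i <= B N) ->
  B @ \oo --> l -> \sum_(0 <= i < n) u i <= l.
Proof.
move=> u0 uB Bl; rewrite -(cvg_lim (@Rhausdorff R) Bl); apply: limr_ge.
  by apply/cvg_ex; exists l.
near=> N; apply: le_trans (uB N).
have nN : (n <= N)%N by near: N; exact: nbhs_infty_ge.
by rewrite [leRHS](big_cat_nat (leq0n n) nN)/= lerDl sumr_ge0.
Unshelve. all: by end_near. Qed.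

(** Third order Taylor expansion about [(x - m) / tau]: the linear term averages to zero and the
    quadratic one to [w / 2 * gcdf2 u] with [w = v / tau ^+ 2], which [gcdf_shrink] absorbs into the
    larger variance [tau ^+ 2 + v]. The Taylor remainder and [gcdf_shrink] each cost at most
    [16 / tau ^+ 3]. *)
Lemma gcdf_step (p g : nat -> R) (m v tau x : R) (n : nat) : 1 <= tau ->
  (forall i, 0 <= p i) -> (forall i, `|g i - m| <= 1) ->
  (fun n => \sum_(0 <= i < n) p i) @ \oo --> (1 : R) ->
  (fun n => \sum_(0 <= i < n) p i * g i) @ \oo --> m ->
  (fun n => \sum_(0 <= i < n) p i * (g i - m) ^+ 2) @ \oo --> v ->
  \sum_(0 <= i < n) p i * gcdf 1 ((x - g i) / tau) <=
    gcdf 1 ((x - m) / Num.sqrt (tau ^+ 2 + v)) + 32 / tau ^+ 3.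
Proof.
move=> tau1 p0 gm pc gc vc.
have tau0 : 0 < tau by exact: lt_le_trans tau1.
have v0 : 0 <= v.
  rewrite -(cvg_lim (@Rhausdorff R) vc); apply: limr_ge; first by apply/cvg_ex; exists v.
  by apply: nearW => N; apply: sumr_ge0 => i _; rewrite mulr_ge0 ?sqr_ge0.
have v1 : v <= 1.
  apply: (ler_cvg_to vc pc); apply: nearW => N; apply: ler_sum => i _.
  by rewrite ler_piMr// -real_normK ?num_real// expr_le1.
set u := (x - m) / tau; set w := v / tau ^+ 2.
have w0 : 0 <= w by rewrite divr_ge0 ?sqr_ge0.
pose T h := gcdf 1 u - h / tau * gpdf u + h ^+ 2 / tau ^+ 2 / 2 * gcdf2 u + 16 / tau ^+ 3.
have le_T i : gcdf 1 ((x - g i) / tau) <= T (g i - m).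
  have := taylor3_ub u ((x - g i) / tau) is_derive_gcdf1 is_derive_gpdf is_derive_gcdf2 gcdf3_le.
  have -> : (x - g i) / tau - u = - ((g i - m) / tau) by rewrite /u; ring.
  rewrite normrN normrM normfV (gtr0_norm tau0) sqrrN !exprMn !exprVn => /le_trans; apply.
  rewrite /T lerD//; first by rewrite mulNr.
  rewrite mulrA ler_pM2r ?invr_gt0 ?exprn_gt0//.
  by rewrite ler_piMr// exprn_ile1.
have BE N : \sum_(0 <= i < N) p i * T (g i - m) =
    (gcdf 1 u + 16 / tau ^+ 3) * \sum_(0 <= i < N) p i
    + - (gpdf u / tau) * (\sum_(0 <= i < N) p i * g i - m * \sum_(0 <= i < N) p i)
    + gcdf2 u / (tau ^+ 2 * 2) * \sum_(0 <= i < N) p i * (g i - m) ^+ 2.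
  rewrite mulrBr !mulr_sumr -sumrB -!big_split/=; apply: eq_bigr => i _.
  by rewrite /T; field; rewrite gt_eqF.
have Bc : (fun N => \sum_(0 <= i < N) p i * T (g i - m)) @ \oo -->
    (gcdf 1 u + 16 / tau ^+ 3) * 1 + - (gpdf u / tau) * (m - m * 1) +
    gcdf2 u / (tau ^+ 2 * 2) * v.
  under eq_fun do rewrite BE.
  apply: cvgD; last by apply: cvgM => //; exact: cvg_cst.
  apply: cvgD; first by apply: cvgM => //; exact: cvg_cst.
  apply: cvgM; first exact: cvg_cst.
  by apply: cvgB => //; apply: cvgM => //; exact: cvg_cst.
have := @le_limit_partial_sums (fun i => p i * gcdf 1 ((x - g i) / tau)) _ _ n _ _ Bc.
move=> /(_ (fun i => mulr_ge0 (p0 i) (gcdf_ge0 _ _))) H.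
apply: le_trans (H _) _ => [N|].
  by apply: ler_sum => i _; rewrite ler_wpM2l.
have sq : (x - m) / Num.sqrt (tau ^+ 2 + v) = u / Num.sqrt (1 + w).
  have -> : tau ^+ 2 + v = tau ^+ 2 * (1 + w) by rewrite /w; field; rewrite gt_eqF.
  by rewrite sqrtrM ?sqr_ge0// sqrtr_sqr gtr0_norm// /u invfM mulrA.
have := gcdf_shrink u w0; rewrite -sq.
have -> : gcdf2 u / (tau ^+ 2 * 2) * v = w / 2 * gcdf2 u.
  by rewrite /w; field; rewrite gt_eqF.
(* [w ^+ 2] is [v ^+ 2 / tau ^+ 4], and [v <= 1 <= tau]. *)
have wt : w ^+ 2 <= (tau ^+ 3)^-1.
  have -> : w ^+ 2 = v ^+ 2 / tau * (tau ^+ 3)^-1 by rewrite /w; field; rewrite gt_eqF.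
  rewrite ger_pMl ?invr_gt0 ?exprn_gt0// ler_pdivrMr// mul1r.
  by apply: le_trans tau1; rewrite expr_le1.
move: wt; rewrite mulr1 mulr1 subrr mulr0; lra.
Qed.

End smoothing_step.

(** * Measurability of events determined by countably valued variables *)

Section discrete_measurability.
Context d (Omega : measurableType d).

Lemma measurable_preimage_countable (T : countType) (f : Omega -> T) :
  (forall t, measurable (f @^-1` [set t])) -> forall A : set T, measurable (f @^-1` A).
Proof.
move=> mf A.
have -> : f @^-1` A = \bigcup_t (f @^-1` [set t] `&` [set _ | A t]).
  by apply/seteqP; split=> [w Aw|w [t _ [/= <-]]//]; exists (f w).
apply: countable_bigcupT_measurable => // t.
have [At|At] := pselect (A t).
  by rewrite (_ : [set _ | A t] = setT) ?setIT// -subTset => w.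
by rewrite (_ : [set _ | A t] = set0) ?setI0// -subset0 => w.
Qed.

Lemma measurable_map_iota (T : countType) (Z : nat -> Omega -> T) (m n : nat) (s : seq T) :
  (forall j t, (m <= j < m + n)%N -> measurable (Z j @^-1` [set t])) ->
  measurable [set w | [seq Z j w | j <- iota m n] = s].
Proof.
elim: n m s => [|n IHn] m [|t s] mZ /=.
- by rewrite (_ : mkset _ = setT)// -subTset.
- by rewrite (_ : mkset _ = set0)// -subset0.
- by rewrite (_ : mkset _ = set0)// -subset0.
- rewrite (_ : mkset _ =
      Z m @^-1` [set t] `&` [set w | [seq Z j w | j <- iota m.+1 n] = s]).
    apply: measurableI; first by apply: mZ; lia.
    by apply: IHn => j u jn; apply: mZ; lia.
  by apply/seteqP; split=> w /= [-> ->].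
Qed.

(** Such an event is the preimage of its own image under the map to the list of the first [M]
    values, and lists over a countable type form a countable type. *)
Lemma measurable_dep (T : countType) (Z : nat -> Omega -> T) (M : nat) (A : set Omega) :
  (forall j t, (j < M)%N -> measurable (Z j @^-1` [set t])) ->
  (forall w w', (forall j, (j < M)%N -> Z j w = Z j w') -> A w -> A w') ->
  measurable A.
Proof.
move=> mZ depA; pose f w := [seq Z j w | j <- iota 0 M].
have -> : A = f @^-1` (f @` A).
  apply/seteqP; split=> [w Aw|w [w' Aw' ff]]; first by exists w.
  apply: depA Aw' => j jM; move/eq_in_map : ff; apply.
  by rewrite mem_iota.
apply: measurable_preimage_countable => t.
by apply: measurable_map_iota => j u /andP[_ jM]; exact: mZ.
Qed.

End discrete_measurability.

(** * Normal upper bound for the distribution function of a sum of independent labels *)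

Section independent_sum.
Context {R : realType} d (Omega : measurableType d) (P : probability Omega R).

Definition pr (A : set Omega) : R := fine (P A).

Lemma prE A : measurable A -> P A = (pr A)%:E.
Proof. by move=> mA; rewrite /pr fineK// fin_num_measure. Qed.

Lemma pr_le A B : measurable A -> measurable B -> A `<=` B -> pr A <= pr B.
Proof. by move=> mA mB AB; rewrite -lee_fin -!prE// le_measure ?inE. Qed.

(** Countable additivity over the fibres of [Z]. Bounds on finite partial sums are what [gcdf_step]
    delivers. *)
Lemma pr_fiber_le (Z : Omega -> nat) (E : set Omega) (B : R) :
  (forall i, measurable (Z @^-1` [set i])) -> measurable E ->
  (forall n, \sum_(0 <= i < n) pr (E `&` Z @^-1` [set i]) <= B) -> pr E <= B.
Proof.
move=> mZ mE EB.
pose F i := E `&` Z @^-1` [set i].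
have mF i : measurable (F i) by exact: measurableI.
have UF : \bigcup_i F i = E.
  by apply/seteqP; split=> [w [i _ []]//|w Ew]; exists (Z w).
have tF : trivIset setT F.
  apply/trivIsetP => i j _ _ ij; rewrite -subset0 => w [[_ Zi] [_ Zj]].
  by move: ij; rewrite -Zi -Zj eqxx.
have := @measure_semi_sigma_additive _ _ _ P F mF tF.
rewrite UF => /(_ mE).
rewrite (_ : (fun n => _) = EFin \o (fun n => \sum_(0 <= i < n) pr (F i))); last first.
  by apply/funext => n /=; rewrite -sumEFin; apply: eq_bigr => i _; rewrite prE.
rewrite [X in _ --> X](_ : _ = (pr E)%:E); last exact: prE.
move=> /fine_cvg /= c.
rewrite -(cvg_lim (@Rhausdorff R) c); apply: limr_le; first by apply/cvg_ex; eexists; exact: c.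
by apply: nearW => n; exact: EB.
Qed.

Variables (M : nat) (Z : nat -> Omega -> nat) (p g : nat -> nat -> R)
  (mean var : nat -> R).
Hypothesis mZ : forall j i, measurable (Z j @^-1` [set i]).
Hypothesis p_ge0 : forall j i, 0 <= p j i.
Hypothesis p_sum : forall j, (fun n => \sum_(0 <= i < n) p j i) @ \oo --> (1 : R).
Hypothesis g_bound : forall j i, `|g j i - mean j| <= 1.
Hypothesis meanE : forall j,
  (fun n => \sum_(0 <= i < n) p j i * g j i) @ \oo --> mean j.
Hypothesis varE : forall j,
  (fun n => \sum_(0 <= i < n) p j i * (g j i - mean j) ^+ 2) @ \oo --> var j.
(** Independence and the laws of the labels enter through this upper bound, since probabilities are
    only ever bounded from above. *)
Hypothesis cylinder : forall a : nat -> nat,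
  pr [set w | forall j, (j < M)%N -> Z j w = a j] <= \prod_(0 <= j < M) p j (a j).

(** The labels before [m] are frozen to [a]; the others are constrained only through their sum.
    Averaging lowers [m] from [M] to 0. *)
Let event (m : nat) (a : nat -> nat) (x : R) : set Omega :=
  [set w | (forall j, (j < m)%N -> Z j w = a j) /\
           \sum_(m <= j < M) g j (Z j w) <= x].

Let measurable_event m a x : (m <= M)%N -> measurable (event m a x).
Proof.
move=> mM; apply: (@measurable_dep _ _ _ Z M) => [j t _ //|w w' ww' [wa wx]].
split=> [j jm|]; first by rewrite -ww' ?wa//; exact: leq_trans mM.
by move: wx; congr (_ <= _); apply: eq_big_nat => j /andP[_ jM]; rewrite ww'.
Qed.

Lemma var_ge0 j : 0 <= var j.
Proof.
rewrite -(cvg_lim (@Rhausdorff R) (@varE j)); apply: limr_ge.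
  by apply/cvg_ex; eexists; exact: varE.
by apply: nearW => N; apply: sumr_ge0 => i _; rewrite mulr_ge0 ?sqr_ge0.
Qed.

(* The labels are averaged out one at a time, the last one first; each
   average costs one [gcdf_step].  The slack [a0] with the term
   [1 - gcdf 1 (a0 / tau)] replaces the initial indicator by a smooth function. *)
Lemma cylinder_tail_le (tau a0 : R) (l : nat) (a : nat -> nat) (x : R) :
  1 <= tau -> (l <= M)%N ->
  pr (event (M - l) a x) <= (\prod_(0 <= j < M - l) p j (a j)) *
    (gcdf 1 ((x + a0 - \sum_(M - l <= j < M) mean j) /
             Num.sqrt (tau ^+ 2 + \sum_(M - l <= j < M) var j))
     + (1 - gcdf 1 (a0 / tau)) + l%:R * (32 / tau ^+ 3)).
Proof.
move=> tau1.
have tau0 : 0 < tau by exact: lt_le_trans tau1.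
elim: l a x => [|l IHl] a x lM.
  have := @measurable_event M a x (leqnn _).
  rewrite subn0 !(big_geq (leqnn M)) subr0 addr0 sqrtr_sqr gtr0_norm// mul0r addr0 => mE.
  have prod0 : 0 <= \prod_(0 <= j < M) p j (a j) by apply: prodr_ge0.
  (* No label is left to sum. For [x < 0] the event is empty; for [0 <= x] the bracket on the right
     is at least 1, since [gcdf 1] is monotone. *)
  have [x0|x0] := leP 0 x; last first.
    rewrite (_ : event _ _ _ = set0); last first.
      by rewrite -subset0 => w [_]; rewrite big_geq// leNgt x0.
    rewrite /pr measure0 mulr_ge0// addr_ge0 ?gcdf_ge0// subr_ge0.
    exact: gcdf_le1.
  apply: le_trans (_ : \prod_(0 <= j < M) p j (a j) * 1 <= _).
    rewrite mulr1; apply: le_trans (cylinder a); apply: pr_le => //.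
      apply: (@measurable_dep _ _ _ Z M) => [j t _ //|w w' ww' wa j jM].
      by rewrite -ww' ?wa.
    by move=> w [].
  rewrite ler_wpM2l//.
  have : gcdf 1 (a0 / tau) <= gcdf 1 ((x + a0) / tau).
    by apply: gcdf_le; rewrite ler_pM2r ?invr_gt0// lerDr.
  lra.
set m := (M - l.+1)%N.
have mE : (M - l)%N = m.+1 by rewrite /m; lia.
have mM : (m < M)%N by rewrite /m; lia.
rewrite mE in IHl.
set V := \sum_(m.+1 <= j < M) var j in IHl.
set S := \sum_(m.+1 <= j < M) mean j in IHl.
have V0 : 0 <= V by apply: sumr_ge0 => j _; exact: var_ge0.
(* The width reached after averaging the labels beyond [m]. As [tau <= tau'], the next step costs no
   more than [32 / tau ^+ 3]. *)
pose tau' := Num.sqrt (tau ^+ 2 + V).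
have tau'2 : tau' ^+ 2 = tau ^+ 2 + V by rewrite sqr_sqrtr// addr_ge0// sqr_ge0.
have tautau' : tau <= tau'.
  by rewrite -[leLHS]gtr0_norm// -sqrtr_sqr ler_wsqrtr// lerDl.
have tau'1 : 1 <= tau' by exact: le_trans tautau'.
set pi0 := \prod_(0 <= j < m) p j (a j).
have pi0_ge0 : 0 <= pi0 by apply: prodr_ge0.
set c := (1 - gcdf 1 (a0 / tau)) + l%:R * (32 / tau ^+ 3).
have c0 : 0 <= c.
  by rewrite addr_ge0 ?subr_ge0 ?gcdf_le1// mulr_ge0// divr_ge0// exprn_ge0 ?ltW.
apply: (pr_fiber_le (mZ m)) => [|n]; first by apply: measurable_event; lia.
have fiber i : pr (event m a x `&` Z m @^-1` [set i]) <=
    pi0 * p m i * (gcdf 1 ((x + a0 - S - g m i) / tau') + c).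
  (* Fixing label [m] to [i] turns the fibre into an event with one more frozen label and threshold
     [x - g m i]. *)
  pose a' j := if j == m then i else a j.
  have -> : event m a x `&` Z m @^-1` [set i] = event m.+1 a' (x - g m i).
    apply/seteqP; split=> w /=.
      move=> [[wa wx] Zi]; split; last by move: wx; rewrite big_ltn// Zi lerBrDl.
      move=> j; rewrite ltnS leq_eqVlt /a' => /orP[/eqP ->|jm]; first by rewrite eqxx.
      by rewrite ltn_eqF// wa.
    move=> [wa wx]; have Zi : Z m w = i by rewrite wa// /a' eqxx.
    split=> //; split; last by rewrite big_ltn// Zi -lerBrDl.
    by move=> j jm; rewrite (wa j (leqW jm)) /a' ltn_eqF.
  have := IHl a' (x - g m i) (ltnW lM).
  have -> : \prod_(0 <= j < m.+1) p j (a' j) = pi0 * p m i.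
    rewrite big_nat_recr//=; congr (_ * _); last by rewrite /a' eqxx.
    by apply: eq_big_nat => j /andP[_ jm]; rewrite /a' ltn_eqF.
  have -> : x - g m i + a0 - S = x + a0 - S - g m i by ring.
  by rewrite -addrA.
apply: le_trans (ler_sum _ (fun i _ => fiber i)) _.
under eq_bigr do rewrite -mulrA.
rewrite -mulr_sumr ler_wpM2l//.
under eq_bigr do rewrite mulrDr.
rewrite big_split/= -mulr_suml.
have step := @gcdf_step _ (p m) (g m) (mean m) (var m) tau' (x + a0 - S) n tau'1
  (p_ge0 m) (g_bound m) (@p_sum m) (@meanE m) (@varE m).
have p1 : \sum_(0 <= i < n) p m i <= 1.
  exact: (@le_limit_partial_sums _ _ (fun N => \sum_(0 <= i < N) p m i) 1 n (p_ge0 m)).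
have pc : (\sum_(0 <= i < n) p m i) * c <= c by rewrite ler_piMl.
apply: le_trans (lerD step pc) _.
have -> : \sum_(m <= j < M) mean j = mean m + S by rewrite big_ltn.
have -> : \sum_(m <= j < M) var j = var m + V by rewrite big_ltn.
rewrite tau'2 -[in leRHS](addrC V) -[in leRHS](addrC S) !addrA opprD addrA.
have t3 : 32 / tau' ^+ 3 <= 32 / tau ^+ 3.
  have tau'0 : 0 < tau' by exact: lt_le_trans tau0 tautau'.
  rewrite ler_pM2l// lef_pV2 ?posrE ?exprn_gt0//.
  by apply: lerXn2r => //; rewrite nnegrE ltW.
rewrite -(@natr1 _ l) [(l%:R + 1) * _]mulrDl mul1r /c; lra.
Qed.

Lemma sum_tail_le (tau a0 x : R) : 1 <= tau ->
  pr [set w | \sum_(0 <= j < M) g j (Z j w) <= x] <=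
    gcdf 1 ((x + a0 - \sum_(0 <= j < M) mean j) /
             Num.sqrt (tau ^+ 2 + \sum_(0 <= j < M) var j))
     + (1 - gcdf 1 (a0 / tau)) + M%:R * (32 / tau ^+ 3).
Proof.
move=> tau1; have := @cylinder_tail_le tau a0 M (fun=> 0%N) x tau1 (leqnn _).
rewrite subnn [X in X * _]big_geq// mul1r; apply: le_trans.
rewrite le_eqVlt; apply/orP; left; apply/eqP; congr pr.
by apply/seteqP; split=> w /=; [split|case].
Qed.

End independent_sum.

(** * Means and variances of the label weights as limits of partial sums *)

Section label_moments.
Context {R : realType}.
Implicit Types (r s : nat -> R).

Lemma le1_prob_vector r : (forall i, 0 <= r i) ->
  (fun n => \sum_(0 <= i < n) r i) @ \oo --> (1 : R) -> forall i, r i <= 1.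
Proof.
move=> r0 r1 i.
have := @le_limit_partial_sums _ r (fun n => \sum_(0 <= i < n) r i) 1 i.+1 r0 (fun=> lexx _) r1.
by rewrite big_nat_recr//=; apply: le_trans; rewrite lerDr sumr_ge0.
Qed.

(** Partial sums are monotone and dominated by those of [r]. This justifies the [limn] in the
    definitions of the moments. *)
Lemma cvg_weighted_sum (r f : nat -> R) : (forall i, 0 <= r i) -> (forall i, 0 <= f i <= 1) ->
  (fun n => \sum_(0 <= i < n) r i) @ \oo --> (1 : R) ->
  (fun n => \sum_(0 <= i < n) r i * f i) @ \oo -->
    limn (fun n => \sum_(0 <= i < n) r i * f i).
Proof.
move=> r0 f01 r1.
have : cvgn (fun n => \sum_(0 <= i < n) r i * f i).
  apply: nondecreasing_is_cvgn.
    move=> m n mn; rewrite [leRHS](big_cat_nat (leq0n m) mn)/= lerDl sumr_ge0// => i _.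
    by rewrite mulr_ge0//; case/andP: (f01 i).
  exists 1 => _ [n _ <-].
  apply: (@le_limit_partial_sums _ _ (fun n => \sum_(0 <= i < n) r i) 1) => //.
    by move=> i; rewrite mulr_ge0//; case/andP: (f01 i).
  by move=> N; apply: ler_sum => i _; rewrite ler_piMr//; case/andP: (f01 i).
by [].
Qed.

Lemma cvg_mu r s : (forall i, 0 <= r i) -> (forall i, 0 <= s i) ->
  (fun n => \sum_(0 <= i < n) r i) @ \oo --> (1 : R) ->
  (fun n => \sum_(0 <= i < n) s i) @ \oo --> (1 : R) ->
  (fun n => \sum_(0 <= i < n) r i * s i) @ \oo --> mu_rs r s.
Proof.
move=> r0 s0 r1 s1; apply: cvg_weighted_sum => // i.
by rewrite s0 le1_prob_vector.
Qed.

Lemma mu_rs01 r s : (forall i, 0 <= r i) -> (forall i, 0 <= s i) ->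
  (fun n => \sum_(0 <= i < n) r i) @ \oo --> (1 : R) ->
  (fun n => \sum_(0 <= i < n) s i) @ \oo --> (1 : R) -> 0 <= mu_rs r s <= 1.
Proof.
move=> r0 s0 r1 s1; have c := cvg_mu r0 s0 r1 s1; apply/andP; split.
  rewrite -(cvg_lim (@Rhausdorff R) c); apply: limr_ge.
    by apply/cvg_ex; eexists; exact: c.
  by apply: nearW => N; apply: sumr_ge0 => i _; rewrite mulr_ge0.
apply: (ler_cvg_to c r1); apply: nearW => N; apply: ler_sum => i _.
by rewrite ler_piMr// le1_prob_vector.
Qed.

(** Expanding the square links the definition as second moment minus squared mean to the centred
    form that [gcdf_step] takes. *)
Lemma cvg_sigmaR2 r s : (forall i, 0 <= r i) -> (forall i, 0 <= s i) ->
  (fun n => \sum_(0 <= i < n) r i) @ \oo --> (1 : R) ->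
  (fun n => \sum_(0 <= i < n) s i) @ \oo --> (1 : R) ->
  (fun n => \sum_(0 <= i < n) r i * (s i - mu_rs r s) ^+ 2) @ \oo --> sigmaR2 r s.
Proof.
move=> r0 s0 r1 s1; have c := cvg_mu r0 s0 r1 s1.
have c2 : (fun n => \sum_(0 <= i < n) r i * s i ^+ 2) @ \oo -->
    limn (fun n => \sum_(0 <= i < n) r i * s i ^+ 2).
  by apply: cvg_weighted_sum => // i; rewrite sqr_ge0 expr_le1// le1_prob_vector.
set m := mu_rs r s in c *.
have -> : (fun n => \sum_(0 <= i < n) r i * (s i - m) ^+ 2) =
    (fun n => \sum_(0 <= i < n) r i * s i ^+ 2 - (2 * m) * \sum_(0 <= i < n) r i * s i
              + m ^+ 2 * \sum_(0 <= i < n) r i).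
  apply/funext => n; rewrite !mulr_sumr -sumrB -big_split/=.
  by apply: eq_bigr => i _; ring.
have -> : sigmaR2 r s = limn (fun n => \sum_(0 <= i < n) r i * s i ^+ 2) -
    (2 * m) * m + m ^+ 2 * 1 by rewrite /sigmaR2 -/m; ring.
apply: cvgD; last by apply: cvgM => //; exact: cvg_cst.
by apply: cvgB => //; apply: cvgM => //; exact: cvg_cst.
Qed.

Lemma sigmaR2_ge0 r s : (forall i, 0 <= r i) -> (forall i, 0 <= s i) ->
  (fun n => \sum_(0 <= i < n) r i) @ \oo --> (1 : R) ->
  (fun n => \sum_(0 <= i < n) s i) @ \oo --> (1 : R) -> 0 <= sigmaR2 r s.
Proof.
move=> r0 s0 r1 s1; have c := cvg_sigmaR2 r0 s0 r1 s1.
rewrite -(cvg_lim (@Rhausdorff R) c); apply: limr_ge.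
  by apply/cvg_ex; eexists; exact: c.
by apply: nearW => N; apply: sumr_ge0 => i _; rewrite mulr_ge0// sqr_ge0.
Qed.

Lemma mu_rsC r s : mu_rs r s = mu_rs s r.
Proof.
by congr (limn _); apply/funext => n; apply: eq_bigr => i _; rewrite mulrC.
Qed.

(** Transfers every fact about [sigmaR2] to [sigmaS2] by exchanging the two vectors. *)
Lemma sigmaS2E r s : sigmaS2 r s = sigmaR2 s r.
Proof. by rewrite /sigmaS2 mu_rsC. Qed.

End label_moments.

(** * The difference of the two weight sums as one sum over interleaved labels *)

Lemma big_nat_double (T : Type) (idx : T) (op : Monoid.com_law idx) (F : nat -> T) n :
  \big[op/idx]_(0 <= j < n.*2) F j = \big[op/idx]_(0 <= j < n) op (F j.*2) (F j.*2.+1).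
Proof.
elim: n => [|n IHn]; first by rewrite !big_geq.
by rewrite doubleS !big_nat_recr//= IHn Monoid.mulmA.
Qed.

Lemma sum_nat_lt_cond (V : nmodType) (F : nat -> V) (k n : nat) : (k <= n)%N ->
  \sum_(0 <= j < n) (if (j < k)%N then F j else 0) = \sum_(0 <= j < k) F j.
Proof.
move=> kn; rewrite (big_cat_nat (leq0n k) kn)/=.
have -> : \sum_(k <= j < n) (if (j < k)%N then F j else 0) = 0.
  by rewrite big_nat; apply: big1 => j /andP[kj _]; rewrite ltnNge kj.
by rewrite addr0; apply: eq_big_nat => j /andP[_ ->].
Qed.

Section gamma_difference.
Context {R : realType} d (Omega : measurableType d) (P : probability Omega R).
Variables (r s : nat -> R) (LR LS : nat -> Omega -> nat) (F0 : set (set Omega)).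
Hypothesis (r_ge0 : forall i, 0 <= r i) (s_ge0 : forall i, 0 <= s i).
Hypothesis r_sum : (fun n => \sum_(0 <= i < n) r i) @ \oo --> (1 : R).
Hypothesis s_sum : (fun n => \sum_(0 <= i < n) s i) @ \oo --> (1 : R).
Hypothesis model : label_model P r s LR LS F0.

(** Even positions carry the labels of [LR], odd ones those of [LS]; the successor is there because
    labels are numbered from 1. *)
Let Z (j : nat) (w : Omega) : nat := if odd j then LS j./2.+1 w else LR j./2.+1 w.
Let p (j : nat) : nat -> R := if odd j then s else r.

Let interleaved_cylinder n (a : nat -> nat) :
  pr P [set w | forall j, (j < n.*2)%N -> Z j w = a j] <= \prod_(0 <= j < n.*2) p j (a j).
Proof.
have [_ _ [F00 F0C _] _ law] := model.
have F0T : F0 setT by rewrite -(setD0 setT); exact: F0C.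
(* The model is used with the sure event of [F0]; the predecessors undo the numbering from 1. *)
have := law _ F0T n (fun j => a j.-1.*2) (fun j => a j.-1.*2.+1).
rewrite setTI probability_setT mul1e => lawn.
rewrite (_ : mkset _ = [set w | forall j, (1 <= j <= n)%N ->
    LR j w = a j.-1.*2 /\ LS j w = a j.-1.*2.+1]); last first.
  apply/seteqP; split=> w /= H j jn.
    case: j jn => // j /= jn; split.
      by rewrite -H ?ltn_double// /Z odd_double doubleK.
    by rewrite -H ?ltn_Sdouble// /Z /= odd_double/= uphalf_double.
  have := H j./2.+1; rewrite -(odd_double_half j) in jn *.
  rewrite /Z half_bit_double oddD odd_double addbF oddb /=.
  have jn2 : (0 < j./2.+1 <= n)%N by move: jn; case: (odd j); lia.
  by move=> /(_ jn2)[]; case: (odd j).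
rewrite /pr lawn/= big_nat_double big_add1/=.
rewrite le_eqVlt; apply/orP; left; apply/eqP; apply: eq_bigr => j _.
by rewrite /p odd_double/= odd_double.
Qed.

(** All [n.*2] interleaved labels are kept, and those beyond [k] or [k'] get weight zero. Unequal
    counts thus need no separate model, and a zero weight adds nothing to mean or variance. *)
Lemma gamma_diff_le (n k k' : nat) (tau a0 y : R) :
  (k <= n)%N -> (k' <= n)%N -> 1 <= tau ->
  pr P [set w | GammaR s LR k w - GammaS r LS k' w <= y] <=
    gcdf 1 ((y + a0 - mu_rs r s * (k%:R - k'%:R)) /
             Num.sqrt (tau ^+ 2 + (sigmaR2 r s * k%:R + sigmaS2 r s * k'%:R)))
     + (1 - gcdf 1 (a0 / tau)) + n.*2%:R * (32 / tau ^+ 3).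
Proof.
move=> kn k'n tau1.
have [mLR mLS _ _ _] := model.
have /andP[mu0 mu1] := mu_rs01 r_ge0 s_ge0 r_sum s_sum.
have rle1 := le1_prob_vector r_ge0 r_sum; have sle1 := le1_prob_vector s_ge0 s_sum.
set mu := mu_rs r s in mu0 mu1 *.
pose g j i := if odd j then (if (j./2 < k')%N then - r i else 0)
                           else (if (j./2 < k)%N then s i else 0).
pose mean j := if odd j then (if (j./2 < k')%N then - mu else 0)
                           else (if (j./2 < k)%N then mu else 0).
pose var j := if odd j then (if (j./2 < k')%N then sigmaS2 r s else 0)
                           else (if (j./2 < k)%N then sigmaR2 r s else 0).
have mZ j i : measurable (Z j @^-1` [set i]).
  by rewrite /Z; case: odd; [exact: mLS|exact: mLR].
have p_ge0 j i : 0 <= p j i by rewrite /p; case: odd.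
have p_sum j : (fun n => \sum_(0 <= i < n) p j i) @ \oo --> (1 : R).
  by rewrite /p; case: odd.
have g_bound j i : `|g j i - mean j| <= 1.
  rewrite /g /mean; have := (r_ge0 i, s_ge0 i, rle1 i, sle1 i) => -[[[? ?] ?] ?].
  case: odd; case: ifP => _; rewrite ?subrr ?normr0// ler_norml; lra.
have cvg0 (q : nat -> R) (c : nat -> R) : (forall i, c i = 0) ->
    (fun n => \sum_(0 <= i < n) q i * c i) @ \oo --> (0 : R).
  move=> c0; rewrite (_ : (fun=> _) = fun=> 0); first exact: cvg_cst.
  by apply/funext => N; apply: big1 => i _; rewrite c0 mulr0.
have meanE j : (fun n => \sum_(0 <= i < n) p j i * g j i) @ \oo --> mean j.
  rewrite /p /g /mean; case: odd; case: ifP => _; try exact: cvg0.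
    under eq_fun do under eq_bigr do rewrite mulrN.
    under eq_fun do rewrite sumrN.
    by apply: cvgN; rewrite /mu mu_rsC; exact: cvg_mu.
  exact: cvg_mu.
have varE j : (fun n => \sum_(0 <= i < n) p j i * (g j i - mean j) ^+ 2) @ \oo --> var j.
  rewrite /p /g /mean /var; case: odd; case: ifP => _;
    try by apply: cvg0 => i; rewrite subrr expr0n.
    under eq_fun do under eq_bigr do rewrite -opprD sqrrN.
    by rewrite sigmaS2E /mu mu_rsC; exact: cvg_sigmaR2.
  exact: cvg_sigmaR2.
have := sum_tail_le mZ p_ge0 p_sum g_bound meanE varE (@interleaved_cylinder n) a0 y tau1.
have interleaved_sum (f h : nat -> R) :
    \sum_(0 <= j < n.*2) (if odd j then (if (j./2 < k')%N then f j./2 else 0)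
                           else (if (j./2 < k)%N then h j./2 else 0)) =
    \sum_(0 <= j < k) h j + \sum_(0 <= j < k') f j.
  rewrite big_nat_double big_split/= -(sum_nat_lt_cond h kn) -(sum_nat_lt_cond f k'n).
  by congr (_ + _); apply: eq_bigr => j _ /=; rewrite odd_double/= ?doubleK ?uphalf_double.
have -> : \sum_(0 <= j < n.*2) mean j = mu * (k%:R - k'%:R).
  rewrite (interleaved_sum (fun=> - mu) (fun=> mu)) !sumr_const_nat !subn0.
  by rewrite mulrBr !mulr_natr mulNrn.
have -> : \sum_(0 <= j < n.*2) var j = sigmaR2 r s * k%:R + sigmaS2 r s * k'%:R.
  rewrite (interleaved_sum (fun=> sigmaS2 r s) (fun=> sigmaR2 r s)) !sumr_const_nat !subn0.
  by rewrite !mulr_natr.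
rewrite (_ : [set w | _] = [set w | GammaR s LR k w - GammaS r LS k' w <= y])//.
suff E w : \sum_(0 <= j < n.*2) g j (Z j w) = GammaR s LR k w - GammaS r LS k' w.
  by apply/seteqP; split=> w /=; rewrite E.
rewrite /GammaR /GammaS !big_add1/= -sumrN.
rewrite -(interleaved_sum (fun j => - r (LS j.+1 w)) (fun j => s (LR j.+1 w))).
by apply: eq_bigr => j _; rewrite /g /Z; case: odd.
Qed.

End gamma_difference.

(** * Pathwise consequences of greediness *)

Section greedy_paths.
Context {R : realType} d (Omega : measurableType d).
Variables (r s : nat -> R) (LR LS : nat -> Omega -> nat) (C : nat -> Omega -> bool).
Hypothesis (r_ge0 : forall i, 0 <= r i) (s_ge0 : forall i, 0 <= s i).

Lemma RcountS n w : Rcount C n.+1 w = (Rcount C n w + C n.+1 w)%N.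
Proof. by rewrite /Rcount big_nat_recr. Qed.

Lemma Rcount_le n w : (Rcount C n w <= n)%N.
Proof.
by elim: n => [|n IHn]; [rewrite /Rcount big_geq|rewrite RcountS; case: (C _ _); lia].
Qed.

Lemma ScountS n w : Scount C n.+1 w = (Scount C n w + ~~ C n.+1 w)%N.
Proof.
by have := Rcount_le n w; rewrite /Scount RcountS; case: (C n.+1 w) => /=; lia.
Qed.

Lemma GammaR_le m n w : (m <= n)%N -> GammaR s LR m w <= GammaR s LR n w.
Proof.
move=> mn; rewrite /GammaR (@big_cat_nat _ _ _ m.+1 1 n.+1)//= lerDl.
by apply: sumr_ge0.
Qed.

Lemma GammaS_le m n w : (m <= n)%N -> GammaS r LS m w <= GammaS r LS n w.
Proof.
move=> mn; rewrite /GammaS (@big_cat_nat _ _ _ m.+1 1 n.+1)//= lerDl.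
by apply: sumr_ge0.
Qed.

Hypothesis (r_le1 : forall i, r i <= 1) (s_le1 : forall i, s i <= 1).
Hypothesis policy : greedy r s LR LS C.

(** Each record read increases a sum that is not the larger one, by an amount in [[0, 1]], so the
    gap never leaves [[-1, 1]]. *)
Lemma greedy_gap n w :
  `|GammaS r LS (Scount C n w) w - GammaR s LR (Rcount C n w) w| <= 1.
Proof.
elim: n => [|n IHn].
  have R0 := Rcount_le 0 w; rewrite leqn0 in R0.
  by rewrite /Scount (eqP R0) /GammaR /GammaS !big_geq// subrr normr0.
(* The inequalities are weak because ties are broken arbitrarily. The first reading is not governed
   by [greedy], but both sums are then empty. *)
have step : (C n.+1 w -> GammaR s LR (Rcount C n w) w <= GammaS r LS (Scount C n w) w) /\
    (~~ C n.+1 w -> GammaS r LS (Scount C n w) w <= GammaR s LR (Rcount C n w) w).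
  case: n {IHn} => [|n].
    have R0 := Rcount_le 0 w; rewrite leqn0 in R0.
    by rewrite /Scount (eqP R0) /GammaR /GammaS !big_geq.
  have [h1 h2] := @policy n.+1 w isT.
  by split=> Cn; rewrite leNgt; apply/negP; [move/h2|move/h1] => E; rewrite E in Cn.
move: step IHn; rewrite RcountS ScountS.
set a := Rcount C n w; set b := Scount C n w.
have GR : GammaR s LR a.+1 w = GammaR s LR a w + s (LR a.+1 w).
  by rewrite /GammaR big_nat_recr.
have GS : GammaS r LS b.+1 w = GammaS r LS b w + r (LS b.+1 w).
  by rewrite /GammaS big_nat_recr.
have := (r_ge0 (LS b.+1 w), r_le1 (LS b.+1 w), s_ge0 (LR a.+1 w), s_le1 (LR a.+1 w)).
case=> [[[? ?] ?] ?]; rewrite !ler_norml.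
case: (C n.+1 w) => /= -[h1 h2] /andP[l1 l2]; rewrite ?addn0 ?addn1 ?GR ?GS.
  by have {}h1 := h1 isT; apply/andP; split; lra.
by have {}h2 := h2 isT; apply/andP; split; lra.
Qed.

Lemma Rcount_le_gamma n k w : (Rcount C n w <= k)%N ->
  GammaS r LS (n - k) w - GammaR s LR k w <= 1.
Proof.
move=> Rk; have := greedy_gap n w; rewrite ler_norml => /andP[_ gap].
have := GammaR_le w Rk.
have : GammaS r LS (n - k) w <= GammaS r LS (Scount C n w) w.
  by apply: GammaS_le; rewrite /Scount leq_sub2l.
lra.
Qed.

Lemma Rcount_gt_gamma n k w : (k < Rcount C n w)%N ->
  GammaR s LR k w - GammaS r LS (n - k) w <= 1.
Proof.
move=> kR; have := greedy_gap n w; rewrite ler_norml => /andP[gap _].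
have := GammaR_le w (ltnW kR).
have : GammaS r LS (Scount C n w) w <= GammaS r LS (n - k) w.
  by apply: GammaS_le; rewrite /Scount leq_sub2l// ltnW.
lra.
Qed.

End greedy_paths.

(** * Measurability of the policy and of the count *)

Section policy_measurability.
Context d (Omega : measurableType d).
Variables (LR LS : nat -> Omega -> nat) (C : nat -> Omega -> bool) (F0 : set (set Omega)).
Hypothesis mLR : forall n i, measurable (LR n @^-1` [set i]).
Hypothesis mLS : forall n i, measurable (LS n @^-1` [set i]).
Hypothesis F0m : F0 `<=` measurable.
Hypothesis adapted : reading_policy F0 LR LS C.

Lemma history_dep n w w' :
  (forall j, (1 <= j <= n)%N -> [/\ C j w = C j w', LR j w = LR j w' & LS j w = LS j w']) ->
  history LR LS C n w = history LR LS C n w'.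
Proof.
move=> ww'; have Rww' : Rcount C n w = Rcount C n w'.
  by apply: eq_big_nat => j jn; have [] := ww' j jn => ->.
rewrite /history /Scount Rww'; congr pair; apply/eq_in_map => j; rewrite mem_iota => jn.
  have [] // := ww' j; have := Rcount_le C n w'; lia.
have [] // := ww' j; lia.
Qed.

(** Strong induction on [n]: the filtration is built from [C] itself, so its sets are measurable
    once the earlier choices are, these and the labels determining the history. *)
Lemma measurable_policy n b : (1 <= n)%N -> measurable (C n @^-1` [set b]).
Proof.
elim/ltn_ind: n b => n IHn b n1.
suff mC : measurable [set w | C n w].
  case: b.
    rewrite (_ : _ @^-1` _ = [set w | C n w])//.
  rewrite (_ : _ @^-1` _ = ~` [set w | C n w]); first exact: measurableC.
  by apply/seteqP; split=> w /=; [move=> ->|move/negP/negbTE].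
move: (adapted n1); rewrite /filtr; apply: smallest_sub.
  exact: sigma_algebra_measurable.
move=> A [/F0m//|[B _ <-]].
pose Z j w := (C j.+1 w, LR j.+1 w, LS j.+1 w).
apply: (@measurable_dep _ _ _ Z n.-1) => [j [[b' x] y] jn|w w' ww'].
  rewrite (_ : _ @^-1` _ =
      C j.+1 @^-1` [set b'] `&` LR j.+1 @^-1` [set x] `&` LS j.+1 @^-1` [set y]).
    apply: measurableI => //; apply: measurableI => //.
    by apply: IHn => //; lia.
  by apply/seteqP; split=> w /=; rewrite /Z; [case=> -> -> ->|case=> -[-> ->] ->].
rewrite /= (@history_dep _ w w')// => -[//|j] jn.
have /ww' [-> -> ->] // : (j < n.-1)%N by lia.
Qed.

Lemma measurable_Rcount n (A : set nat) : measurable [set w | A (Rcount C n w)].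
Proof.
apply: (@measurable_dep _ _ _ (fun j => C j.+1) n) => [j b _|w w' ww' /=].
  exact: measurable_policy.
rewrite (_ : Rcount C n w = Rcount C n w')//.
by apply: eq_big_nat => -[//|j] jn; rewrite ww'.
Qed.

End policy_measurability.

(** * Limit of the normal upper bound under the chosen scales *)

Section scaling_limit.
Context {R : realType}.

(* Scales with [n = q ^+ 20]: the smoothing width [tau = q ^+ 8] and the slack
   [q ^+ 9] are both [o(sqrt n)], the slack dominates the width, and the
   accumulated error [n / tau ^+ 3 = q ^- 4] vanishes. *)
Definition root20 (n : nat) : R := n%:R `^ (20%:R^-1).

Lemma root20_ge0 n : 0 <= root20 n.
Proof. exact: powR_ge0. Qed.

Lemma root20K n : root20 n ^+ 20 = n%:R.
Proof. by rewrite -powR_mulrn ?root20_ge0// /root20 -powRrM mulVf// powRr1. Qed.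

Lemma sqrt_root20 n : Num.sqrt n%:R = root20 n ^+ 10.
Proof.
rewrite -root20K (_ : root20 n ^+ 20 = (root20 n ^+ 10) ^+ 2); last by rewrite -exprM.
by rewrite sqrtr_sqr ger0_norm// exprn_ge0// root20_ge0.
Qed.

Lemma root20_gt0 n : (0 < n)%N -> 0 < root20 n.
Proof. by move=> n0; rewrite powR_gt0// ltr0n. Qed.

Lemma root20_ge1 n : (0 < n)%N -> 1 <= root20 n.
Proof.
move=> n0; rewrite -(@ler_pXn2r _ 20)// ?nnegrE ?root20_ge0//.
by rewrite root20K expr1n ler1n.
Qed.

Lemma cvg_root20 : root20 n @[n --> \oo] --> +oo.
Proof.
apply/cvgryPge => A; near=> n.
have [A0|A0] := leP A 0; first exact: le_trans (root20_ge0 _).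
rewrite -(@ler_pXn2r _ 20)// ?nnegrE ?root20_ge0 ?ltW// root20K.
by near: n; exact: nbhs_infty_gtr.
Unshelve. all: by end_near. Qed.

Lemma cvg_root20V : (fun n => (root20 n)^-1) @ \oo --> (0 : R).
Proof.
apply/gtr0_cvgV0; last exact: cvg_root20.
by near=> n; apply: root20_gt0; near: n; exact: nbhs_infty_gt.
Unshelve. all: by end_near. Qed.

Lemma cvg_exprn (u : nat -> R) (l : R) k : u @ \oo --> l -> (fun n => u n ^+ k) @ \oo --> l ^+ k.
Proof.
move=> ul; elim: k => [|k IHk]; first exact: cvg_cst.
rewrite exprS; under eq_fun do rewrite exprS.
exact: cvgM.
Qed.

(** With [q = root20 n], numerator and denominator are divided by [q ^+ 10], the square root of [n].
    The gap 1 and the slack become [rho ^+ 10] and [rho], and the accumulated error becomes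
    [64 * rho ^+ 4]. The hypothesis forces [k n / n] to 1/2, whence the limiting variance
    [(vR + vS) / 2]. *)
Lemma cvg_smoothing_bound (c e vR vS : R) (k : nat -> nat) : 0 < vR + vS ->
  (fun n => ((k n)%:R - (n%:R - (k n)%:R)) / Num.sqrt n%:R) @ \oo --> e ->
  (fun n => gcdf 1 ((1 + root20 n ^+ 9 + c * ((k n)%:R - (n%:R - (k n)%:R))) /
      Num.sqrt ((root20 n ^+ 8) ^+ 2 + (vR * (k n)%:R + vS * (n%:R - (k n)%:R))))
    + (1 - gcdf 1 (root20 n ^+ 9 / root20 n ^+ 8))
    + n.*2%:R * (32 / (root20 n ^+ 8) ^+ 3)) @ \oo -->
  gcdf 1 (c * e / Num.sqrt ((vR + vS) / 2)).
Proof.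
move=> v0 ce.
set en := fun n => _ in ce.
pose rho n := (root20 n)^-1.
have rho0 : rho @ \oo --> (0 : R) by exact: cvg_root20V.
have rhoX m : (fun n => rho n ^+ m.+1) @ \oo --> (0 : R).
  by have := @cvg_exprn _ _ m.+1 rho0; rewrite expr0n.
(* The total variance divided by [n]; [rho n ^+ 4] is the share of the smoothing. *)
pose V n := rho n ^+ 4 + (vR * (1 / 2 + en n * rho n ^+ 10 / 2) +
                        vS * (1 / 2 - en n * rho n ^+ 10 / 2)).
have : (fun n => gcdf 1 ((rho n ^+ 10 + rho n + c * en n) / Num.sqrt (V n))
    + (1 - gcdf 1 (root20 n)) + 64 * rho n ^+ 4) @ \oo -->
    gcdf 1 ((0 + 0 + c * e) / Num.sqrt ((vR + vS) / 2)) + (1 - 1) + 64 * 0.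
  have erho : (fun n => en n * rho n ^+ 10 / 2) @ \oo --> (0 : R).
    rewrite -[X in _ --> X](_ : e * 0 / 2 = 0); last by rewrite mulr0 mul0r.
    apply: cvgM; last exact: cvg_cst.
    exact: cvgM.
  have Vc : V @ \oo --> (vR + vS) / 2.
    rewrite -[X in _ --> X](_ : 0 + (vR * (1 / 2 + 0) + vS * (1 / 2 - 0)) = (vR + vS) / 2);
      last by ring.
    apply: cvgD => //; apply: cvgD; (apply: cvgM; first exact: cvg_cst).
      by apply: cvgD => //; exact: cvg_cst.
    by apply: cvgB => //; exact: cvg_cst.
  apply: cvgD; last by apply: cvgM => //; exact: cvg_cst.
  apply: cvgD; last first.
    apply: cvgB; first exact: cvg_cst.
    exact: (cvg_comp _ _ cvg_root20 (@cvg_gcdfy R 1)).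
  apply: (continuous_cvg _ (@gcdf_continuous R _)).
  apply: cvgM.
    apply: cvgD; last by apply: cvgM => //; exact: cvg_cst.
    exact: cvgD.
  apply: cvgV; first by rewrite gt_eqF// sqrtr_gt0 divr_gt0.
  exact: (continuous_cvg _ (@sqrt_continuous R _)).
rewrite !add0r subrr addr0 mulr0 addr0; apply: cvg_trans; apply: near_eq_cvg.
near=> n.
have n0 : (0 < n)%N by near: n; exact: nbhs_infty_gt.
have q0 := root20_gt0 n0.
have enE : (k n)%:R - (n%:R - (k n)%:R) = en n * root20 n ^+ 10.
  by rewrite /en sqrt_root20 divfK// expf_neq0// gt_eqF.
have kE : (k n)%:R = root20 n ^+ 20 * (1 / 2 + en n * rho n ^+ 10 / 2).
  have -> : (k n)%:R = (n%:R + en n * root20 n ^+ 10) / 2 by rewrite -enE; field.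
  by rewrite -(root20K n) /rho; field; rewrite gt_eqF.
have nkE : n%:R - (k n)%:R = root20 n ^+ 20 * (1 / 2 - en n * rho n ^+ 10 / 2).
  by rewrite kE -[n%:R]root20K; field.
congr (_ + _ + _).
- congr gcdf; rewrite enE nkE kE.
  have -> : (root20 n ^+ 8) ^+ 2 + (vR * (root20 n ^+ 20 * (1 / 2 + en n * rho n ^+ 10 / 2)) +
      vS * (root20 n ^+ 20 * (1 / 2 - en n * rho n ^+ 10 / 2))) = (root20 n ^+ 10) ^+ 2 * V n.
    by rewrite /V /rho; field; rewrite gt_eqF.
  rewrite sqrtrM ?sqr_ge0// sqrtr_sqr ger0_norm ?exprn_ge0 ?root20_ge0//.
  have -> : 1 + root20 n ^+ 9 + c * (en n * root20 n ^+ 10) =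
      root20 n ^+ 10 * (rho n ^+ 10 + rho n + c * en n).
    by rewrite /rho; field; rewrite gt_eqF.
  by rewrite -mulf_div divff ?mul1r// expf_neq0// gt_eqF.
- congr (1 - gcdf 1 _); field; by rewrite gt_eqF.
- rewrite -muln2 natrM -(root20K n) /rho; field; by rewrite gt_eqF.
Unshelve. all: by end_near. Qed.

End scaling_limit.

(** * Measurability of the comparison events and exchange of the two sources *)

Lemma measurable_gamma_diff (R : realType) d (Omega : measurableType d) (r s : nat -> R)
  (LR LS : nat -> Omega -> nat) (k k' : nat) (y : R) :
  (forall n i, measurable (LR n @^-1` [set i])) ->
  (forall n i, measurable (LS n @^-1` [set i])) ->
  measurable [set w | GammaR s LR k w - GammaS r LS k' w <= y].
Proof.
move=> mLR mLS.
apply: (@measurable_dep _ _ _ (fun j w => (LR j w, LS j w)) (maxn k k').+1) => [j [a b] _|].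
  rewrite (_ : _ @^-1` _ = LR j @^-1` [set a] `&` LS j @^-1` [set b]).
    exact: measurableI.
  by apply/seteqP; split=> w /= [-> ->].
move=> w w' ww' /=; congr (_ - _ <= _); apply: eq_big_nat => j /andP[_ jk].
  by have /ww' [-> _] : (j < (maxn k k').+1)%N by lia.
by have /ww' [_ ->] : (j < (maxn k k').+1)%N by lia.
Qed.

(** Lets [gamma_diff_le] bound the difference of the weight sums in either order. *)
Lemma label_model_sym (R : realType) d (Omega : measurableType d) (P : probability Omega R)
  (r s : nat -> R) (LR LS : nat -> Omega -> nat) (F0 : set (set Omega)) :
  label_model P r s LR LS F0 -> label_model P s r LS LR F0.
Proof.
case=> mLR mLS sF0 F0m law; split=> // A F0A N a b.
rewrite (_ : mkset _ = [set w | forall j, (1 <= j <= N)%N -> LR j w = b j /\ LS j w = a j]).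
  by rewrite law//; congr (_ * _%:E)%E; apply: eq_bigr => j _; rewrite mulrC.
by apply/seteqP; split=> w /= H j jN; have [-> ->] := H j jN.
Qed.

(** * The integer threshold near [n / 2] *)

Section centering.
Context {R : realType}.
Variable x : R.

(** [Num.truncn] is relied on only at nonnegative arguments, which [near_cut] ensures for large
    [n]. *)
Definition cut (n : nat) : nat := Num.truncn (n%:R / 2 + x * Num.sqrt n%:R).

Lemma near_cut : \forall n \near \oo,
  [/\ (0 < n)%N, (cut n)%:R <= n%:R / 2 + x * Num.sqrt n%:R < (cut n).+1%:R,
      0 <= n%:R / 2 + x * Num.sqrt n%:R & (cut n <= n)%N].
Proof.
near=> n.
have n0 : (0 < n)%N by near: n; exact: nbhs_infty_gt.
(* This makes [x * Num.sqrt n%:R] at most [n / 2] in absolute value, so the threshold lies between 0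
   and [n]. *)
have x4 : 4 * x ^+ 2 <= n%:R by near: n; exact: nbhs_infty_ger.
set t : R := Num.sqrt n%:R.
have t0 : 0 <= t by exact: sqrtr_ge0.
have t2 : t ^+ 2 = n%:R by rewrite sqr_sqrtr.
have xt : 2 * `|x| <= t.
  rewrite -(@ler_pXn2r _ 2)// ?nnegrE ?mulr_ge0// t2 exprMn real_normK ?num_real//.
  by apply: le_trans x4; rewrite ler_wpM2r ?sqr_ge0//; lra.
have : `|x| * t <= n%:R / 2 by rewrite -t2; nra.
rewrite -[t in `|x| * t](ger0_norm t0) -normrM ler_norml => /andP[z1 z2].
have z0 : 0 <= n%:R / 2 + x * t by lra.
have kz := truncn_itv z0.
split=> //; rewrite -(ler_nat R).
by move: kz => /andP[kz _]; rewrite -/t /cut -/t; apply: le_trans kz _; lra.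
Unshelve. all: by end_near. Qed.

(** Truncation loses less than 1, hence less than 2 in [2 * cut n - n], and [2 / Num.sqrt n%:R]
    tends to zero. *)
Lemma cvg_cut :
  (fun n => ((cut n)%:R - (n%:R - (cut n)%:R)) / Num.sqrt n%:R) @ \oo --> 2 * x.
Proof.
apply: (@squeeze_cvgr _ _ _ _ (fun n => 2 * x - 2 * (root20 n)^-1 ^+ 10) (fun=> 2 * x)).
- near=> n.
  have [n0 /andP[z1 z2] z0 kn] : [/\ (0 < n)%N,
    (cut n)%:R <= n%:R / 2 + x * Num.sqrt n%:R < (cut n).+1%:R,
      0 <= n%:R / 2 + x * Num.sqrt n%:R & (cut n <= n)%N] by near: n; exact: near_cut.
  have t0 : 0 < Num.sqrt n%:R :> R by rewrite sqrtr_gt0 ltr0n.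
  rewrite exprVn -sqrt_root20; move: z1 z2 t0.
  rewrite -(@natr1 _ (cut n)); set t := Num.sqrt _ => z1 z2 t0.
  rewrite ler_pdivlMr// ler_pdivrMr//; apply/andP; split; last by lra.
  by rewrite mulrBl mulfVK ?gt_eqF//; lra.
- rewrite -[X in _ --> X](_ : 2 * x - 2 * 0 ^+ 10 = 2 * x); last by rewrite expr0n mulr0 subr0.
  apply: cvgB; first exact: cvg_cst.
  apply: cvgM; first exact: cvg_cst.
  exact: cvg_exprn cvg_root20V.
- exact: cvg_cst.
Unshelve. all: by end_near. Qed.

End centering.

(** * Squeezing the distribution function of the normalised count *)

Theorem theorem3p2 (R : realType) (d : measure_display) (Omega : measurableType d)
  (P : probability Omega R) (r s : nat -> R)
  (LR LS : nat -> Omega -> nat) (F0 : set (set Omega)) (C : nat -> Omega -> bool) :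
  (forall i, 0 <= r i) -> (forall i, 0 <= s i) ->
  r 0%N = 0 -> s 0%N = 0 ->
  (fun n => \sum_(0 <= i < n) r i) @ \oo --> (1 : R) ->
  (fun n => \sum_(0 <= i < n) s i) @ \oo --> (1 : R) ->
  0 < mu_rs r s ->
  0 < Num.sqrt (sigmaR2 r s) + Num.sqrt (sigmaS2 r s) ->
  label_model P r s LR LS F0 ->
  reading_policy F0 LR LS C ->
  greedy r s LR LS C ->
  forall x : R,
    (fun n : nat => fine (P [set w | ((Rcount C n w)%:R - n%:R / 2) / Num.sqrt n%:R <= x]))
      @ \oo -->
    fine (normal_prob 0 (Num.sqrt ((sigmaR2 r s + sigmaS2 r s) / (8 * (mu_rs r s) ^+ 2)))
            `]-oo, x]).
Proof.
move=> r0 s0 _ _ r1 s1 mu0 sig0 model adapted policy x.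
have [mLR mLS _ F0m _] := model.
have rle1 := le1_prob_vector r0 r1; have sle1 := le1_prob_vector s0 s1.
have mRcount := measurable_Rcount mLR mLS F0m adapted.
set vR := sigmaR2 r s in sig0 *; set vS := sigmaS2 r s in sig0 *.
set mu := mu_rs r s in mu0 *.
have v0 : 0 < vR + vS.
  have vR0 : 0 <= vR by exact: sigmaR2_ge0.
  have vS0 : 0 <= vS by rewrite /vS sigmaS2E; exact: sigmaR2_ge0.
  rewrite lt_def addr_ge0// andbT; apply/eqP => v00.
  have [vRE vSE] : vR = 0 /\ vS = 0 by split; lra.
  by move: sig0; rewrite vRE vSE sqrtr0 addr0 ltxx.
set sigma := Num.sqrt ((vR + vS) / (8 * mu ^+ 2)).
have sigmaE : sigma = Num.sqrt ((vR + vS) / 2) / (2 * mu).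
  rewrite /sigma; have -> : (vR + vS) / (8 * mu ^+ 2) = (vR + vS) / 2 * ((2 * mu)^-1) ^+ 2.
    by field; rewrite gt_eqF.
  by rewrite sqrtrM ?divr_ge0 ?(ltW v0)// sqrtr_sqr ger0_norm// invr_ge0 mulr_ge0// ltW.
have rt0 : 0 < Num.sqrt ((vR + vS) / 2) by rewrite sqrtr_gt0 divr_gt0.
have sigma0 : 0 < sigma by rewrite sigmaE divr_gt0// mulr_gt0.
rewrite -/(gcdf sigma x) (gcdf_scale _ sigma0).
have limE : x / sigma = mu * (2 * x) / Num.sqrt ((vR + vS) / 2).
  by rewrite sigmaE; field; rewrite !gt_eqF.
(* The slope [c] is [mu] for the event that the count is at most [cut x n], and [- mu] for its
   complement. *)
pose bound c n : R :=
  gcdf 1 ((1 + root20 n ^+ 9 + c * ((cut x n)%:R - (n%:R - (cut x n)%:R))) /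
      Num.sqrt ((root20 n ^+ 8) ^+ 2 + (vR * (cut x n)%:R + vS * (n%:R - (cut x n)%:R))))
    + (1 - gcdf 1 (root20 n ^+ 9 / root20 n ^+ 8))
    + n.*2%:R * (32 / (root20 n ^+ 8) ^+ 3).
have upper_cvg : bound mu @ \oo --> gcdf 1 (x / sigma).
  by rewrite limE; exact: (@cvg_smoothing_bound _ mu _ _ _ _ v0 (@cvg_cut _ x)).
(* The reflection [gcdfN] turns the limit for the complement into the same value. *)
have lower_cvg : (fun n => 1 - bound (- mu) n) @ \oo --> gcdf 1 (x / sigma).
  rewrite -[X in _ --> X](_ : 1 - gcdf 1 (- (x / sigma)) = _); last by rewrite gcdfN; ring.
  apply: cvgB; first exact: cvg_cst.
  by rewrite limE -!mulNr; exact: (@cvg_smoothing_bound _ (- mu) _ _ _ _ v0 (@cvg_cut _ x)).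
apply: squeeze_cvgr lower_cvg upper_cvg.
near=> n.
have [n0 _ z0 kn] : [/\ (0 < n)%N,
    (cut x n)%:R <= n%:R / 2 + x * Num.sqrt n%:R < (cut x n).+1%:R,
      0 <= n%:R / 2 + x * Num.sqrt n%:R & (cut x n <= n)%N] by near: n; exact: near_cut.
have tau1 : 1 <= (root20 n : R) ^+ 8 by rewrite exprn_ege1// root20_ge1.
set k := cut x n in kn *.
(* The count is an integer, so comparing it with the real threshold amounts to comparing it with the
   integer part. *)
have eventE : [set w | ((Rcount C n w)%:R - n%:R / 2) / Num.sqrt n%:R <= x] =
    [set w | (Rcount C n w <= k)%N].
  have t0 : 0 < Num.sqrt n%:R :> R by rewrite sqrtr_gt0 ltr0n.
  apply/seteqP; split=> w /=;
    by rewrite ler_pdivrMr// lerBlDl /k /cut (truncn_ge_nat _ z0).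
rewrite eventE -/(pr P _).
have mle : measurable [set w | (Rcount C n w <= k)%N].
  exact: (mRcount n [set m | (m <= k)%N]).
have mgt : measurable [set w | (k < Rcount C n w)%N].
  exact: (mRcount n [set m | (k < m)%N]).
have compl : pr P [set w | (Rcount C n w <= k)%N] = 1 - pr P [set w | (k < Rcount C n w)%N].
  rewrite (_ : [set w | (Rcount C n w <= k)%N] = ~` [set w | (k < Rcount C n w)%N]).
    by rewrite /pr probability_setC// fineB// fin_num_measure.
  by apply/seteqP; split=> w /=; [rewrite ltnNge => ->|move/negP; rewrite -leqNgt].
have knR : (n - k)%:R = n%:R - k%:R :> R by rewrite natrB.
apply/andP; split.
  rewrite compl lerD2l lerN2.
  apply: le_trans (_ : pr P [set w | GammaR s LR k w - GammaS r LS (n - k) w <= 1] <= _).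
    apply: pr_le => //; first exact: measurable_gamma_diff.
    by move=> w; exact: Rcount_gt_gamma.
  have := gamma_diff_le r0 s0 r1 s1 model (root20 n ^+ 9) 1 kn (leq_subr k n) tau1.
  by rewrite knR /bound -/k -/mu mulNr.
apply: le_trans (_ : pr P [set w | GammaR r LS (n - k) w - GammaS s LR k w <= 1] <= _).
  apply: pr_le => //; first exact: measurable_gamma_diff.
  by move=> w /= Rk; have := Rcount_le_gamma r0 s0 rle1 sle1 policy Rk; apply.
(* The roles of the sources are exchanged here, which reverses the sign of the mean and leaves the
   total variance unchanged. *)
have := gamma_diff_le s0 r0 s1 r1 (label_model_sym model) (root20 n ^+ 9) 1 (leq_subr k n) kn tau1.
rewrite knR mu_rsC -/mu -(sigmaS2E r s) (sigmaS2E s r) -/vR -/vS.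
by rewrite /bound -/k (addrC (vS * _)) -mulrN opprB.
Unshelve. all: by end_near. Qed.
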